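(* Let $R$ be a commutative ring. If $C$ is a semidualizing $R$-module, then $C$ is faithfully semidualizing; that is, for every $R$-module $N$, if $\operatorname{Hom}_R(C,N)=0$ then $N=0$.
   Context: $R$ is a commutative ring with unity, not necessarily noetherian. An $R$-module $C$ (regarded as a symmetric $(R,R)$-bimodule) is semidualizing if: $C$ admits a projective resolution by finitely generated projective $R$-modules; the homothety map $R\to\operatorname{Hom}_R(C,C)$, $r\mapsto(x\mapsto rx)$, is an isomorphism; and $\operatorname{Ext}_R^i(C,C)=0$ for all $i\ge1$. For such $C$, being faithfully semidualizing means that for every $R$-module $N$, $\operatorname{Hom}_R(C,N)=0$ implies $N=0$. *)

(* Defs.v *)
From HB Require Import structures.
From mathcomp Require Import all_boot all_order all_algebra.

Set Implicit Arguments.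
Unset Strict Implicit.
Unset Printing Implicit Defensive.

Import GRing.Theory.
Local Open Scope ring_scope.

Definition zero_module (R : comPzRingType) (M : lmodType R) : Prop :=
  forall x : M, x = 0.

(* Elements of Hom_R(M, N) are compared pointwise. *)
Definition Hom_zero (R : comPzRingType) (M N : lmodType R) : Prop :=
  forall (f : {linear M -> N}) (x : M), f x = 0.

Definition surjective_map (A B : Type) (f : A -> B) : Prop :=
  forall b : B, exists a : A, f a = b.

Definition exact_at (R : comPzRingType) (A B D : lmodType R)
    (f : {linear A -> B}) (g : {linear B -> D}) : Prop :=
  forall b : B, g b = 0 <-> exists a : A, f a = b.

Definition finitely_generated (R : comPzRingType) (M : lmodType R) : Prop :=
  exists (n : nat) (e : 'I_n -> M),
    forall x : M, exists c : 'I_n -> R, x = \sum_(i < n) c i *: e i.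

Definition projective (R : comPzRingType) (P : lmodType R) : Prop :=
  forall (A B : lmodType R) (p : {linear A -> B}) (f : {linear P -> B}),
    surjective_map p ->
    exists g : {linear P -> A}, forall x : P, p (g x) = f x.

Record projective_resolution (R : comPzRingType) (M : lmodType R) := {
  res_module :> nat -> lmodType R;
  res_diff : forall n, {linear res_module n.+1 -> res_module n};
  res_aug : {linear res_module 0%N -> M};
  res_projective : forall n, projective (res_module n);
  res_exact : forall n, exact_at (res_diff n.+1) (res_diff n);
  res_exact_aug : exact_at (res_diff 0%N) res_aug;
  res_aug_surjective : surjective_map res_aug
}.

Definition cocycle (R : comPzRingType) (M N : lmodType R)
    (P : projective_resolution M) (n : nat) (f : {linear P n -> N}) : Prop :=
  forall x : P n.+1, f (res_diff P n x) = 0.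

Definition coboundary (R : comPzRingType) (M N : lmodType R)
    (P : projective_resolution M) (n : nat) : {linear P n -> N} -> Prop :=
  match n return {linear P n -> N} -> Prop with
  | 0%N => fun f => forall x, f x = 0
  | m.+1 => fun f =>
      exists g : {linear P m -> N}, forall x, f x = g (res_diff P m x)
  end.

(* Ext_R^n(M, N) = 0, where Ext_R^n(M, N) is H^n(Hom_R(P, N)) for a projective
   resolution P of M.  As this group does not depend on P up to isomorphism,
   its vanishing is required for every P; every module has such a resolution,
   so the condition is never vacuous. *)
Definition Ext_zero (R : comPzRingType) (n : nat) (M N : lmodType R) : Prop :=
  forall (P : projective_resolution M) (f : {linear P n -> N}),
    cocycle f -> coboundary f.

(* The homothety map R -> Hom_R(C, C) is always R-linear, so it is an
   isomorphism exactly when it is injective and surjective. *)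
Definition homothety_iso (R : comPzRingType) (C : lmodType R) : Prop :=
  (forall r s : R, (forall x : C, r *: x = s *: x) -> r = s) /\
  (forall f : {linear C -> C}, exists r : R, forall x : C, f x = r *: x).

Definition semidualizing (R : comPzRingType) (C : lmodType R) : Prop :=
  [/\ exists P : projective_resolution C, forall n, finitely_generated (P n),
      homothety_iso C
    & forall i : nat, (1 <= i)%N -> Ext_zero i C C].

Definition faithfully_semidualizing (R : comPzRingType) (C : lmodType R) :
    Prop :=
  semidualizing C /\
  forall N : lmodType R, Hom_zero C N -> zero_module N.

(* Main.v *)
Require Import Defs.
From HB Require Import structures.
From mathcomp Require Import all_boot all_order all_algebra.

(* Only finite generation and faithfulness of C matter.  Let e_0, ..., e_(n-1)
   generate C and call a row of coefficients c with sum c_i e_i = 0 a relation.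
   Descending induction on k shows that every k x k minor formed by the first k
   columns of k relations kills N; at k = 0 the empty minor is 1, so N = 0.
   For k = n the minor kills C by Cramer's rule, hence vanishes.  For the step
   from k+1 to k, given k relations and x in N, the map sending sum c_i e_i to
   det(relations, c) x is well defined by the case k+1, hence is zero as
   Hom(C, N) = 0; evaluating it at e_k gives the k x k minor times x. *)

Set Implicit Arguments.
Unset Strict Implicit.
Unset Printing Implicit Defensive.

Import GRing.Theory.
Local Open Scope ring_scope.

Definition faithful_module (R : comPzRingType) (M : lmodType R) : Prop :=
  forall r : R, (forall x : M, r *: x = 0) -> r = 0.

Lemma finitely_generated_surj (R : comPzRingType) (A B : lmodType R)
    (p : {linear A -> B}) :
  surjective_map p -> finitely_generated A -> finitely_generated B.
Proof.
move=> psurj [n [e gen]]; exists n, (fun i => p (e i)) => y.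
have [x <-] := psurj y; have [c ->] := gen x.
by exists c; rewrite linear_sum; apply: eq_bigr => i _; rewrite linearZ.
Qed.

Section HomFromGenerators.

Variables (R : comPzRingType) (C N : lmodType R) (n : nat) (e : 'I_n -> C).
Hypothesis gen :
  forall x : C, exists c : 'I_n -> R, x = \sum_(i < n) c i *: e i.

Let comb (c : 'rV[R]_n) : C := \sum_(i < n) c 0 i *: e i.

Let comb_lin a c d : comb (a *: c + d) = a *: comb c + comb d.
Proof.
rewrite /comb scaler_sumr -big_split; apply: eq_bigr => i _ /=.
by rewrite !mxE scalerDl scalerA.
Qed.

Let gen_row x : exists c : 'rV[R]_n, x == comb c.
Proof.
have [c ->] := gen x; exists (\row_i c i); apply/eqP.
by apply: eq_bigr => i _; rewrite mxE.
Qed.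

(** Choosing coefficients for each element of [C] defines the map; the hypothesis on relations makes
    its value independent of the choice, hence linear. *)
Lemma linear_on_generators (y : 'I_n -> N) :
    (forall c : 'I_n -> R, \sum_(i < n) c i *: e i = 0 ->
       \sum_(i < n) c i *: y i = 0) ->
  exists f : {linear C -> N}, forall i, f (e i) = y i.
Proof.
move=> rel_y; pose val (c : 'rV[R]_n) : N := \sum_(i < n) c 0 i *: y i.
have val_lin a c d : val (a *: c + d) = a *: val c + val d.
  rewrite /val scaler_sumr -big_split; apply: eq_bigr => i _ /=.
  by rewrite !mxE scalerDl scalerA.
have val_eq c d : comb c = comb d -> val c = val d.
  move=> eq_cd; apply/eqP; rewrite eq_sym -subr_eq0 -[- _]scaleN1r addrC.
  rewrite -val_lin; apply/eqP/rel_y.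
  by rewrite -/(comb _) comb_lin eq_cd scaleN1r addNr.
pose f x := val (xchoose (gen_row x)).
have f_comb c : f (comb c) = val c.
  by apply: val_eq; rewrite -(eqP (xchooseP (gen_row (comb c)))).
have f_lin : linear f.
  move=> a u v; have [c /eqP->] := gen_row u; have [d /eqP->] := gen_row v.
  by rewrite -comb_lin !f_comb val_lin.
pose F : {linear C -> N} := HB.pack f (GRing.isLinear.Build R C N *:%R f f_lin).
exists F => i; have -> : e i = comb (delta_mx 0 i).
  rewrite /comb (bigD1 i) //= mxE !eqxx scale1r big1 ?addr0 // => j ne_ji.
  by rewrite mxE (negPf ne_ji) andbF scale0r.
rewrite /F /= f_comb /val (bigD1 i) //= mxE !eqxx scale1r big1 ?addr0 //.
by move=> j ne_ji; rewrite mxE (negPf ne_ji) andbF scale0r.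
Qed.

End HomFromGenerators.

(** Cramer's rule: combining the relations by [\adj A] turns [A] into [\det A] times the
    identity. *)
Lemma det_relations_annihilate (R : comPzRingType) (M : lmodType R) (n : nat)
    (e : 'I_n -> M) (A : 'M[R]_n) :
  (forall i, \sum_(j < n) A i j *: e j = 0) -> forall l, \det A *: e l = 0.
Proof.
move=> relA l.
transitivity (\sum_j (\adj A *m A) l j *: e j).
  rewrite mul_adj_mx (bigD1 l) //= mxE eqxx mulr1n big1 ?addr0 // => j ne_jl.
  by rewrite mxE eq_sym (negPf ne_jl) mulr0n scale0r.
under eq_bigr => j _ do rewrite mxE scaler_suml.
rewrite exchange_big big1 //= => i _.
under eq_bigr => j _ do rewrite -scalerA.
by rewrite -scaler_sumr relA scaler0.
Qed.

(* Coefficient rows are indexed by nat so that leading minors of every size are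
   taken without casts; only the entries below n are constrained. *)
Lemma leading_minors_annihilate (R : comPzRingType) (C N : lmodType R) (n : nat)
    (e : 'I_n -> C) :
    (forall x : C, exists c : 'I_n -> R, x = \sum_(i < n) c i *: e i) ->
    faithful_module C -> Hom_zero C N ->
  forall k, (k <= n)%N -> forall r : nat -> nat -> R,
    (forall i, (i < k)%N -> \sum_(j < n) r i j *: e j = 0) ->
  forall x : N, \det (\matrix_(i < k, j < k) r i j) *: x = 0.
Proof.
move=> gen faithC homCN k; have [m] := ubnP (n - k).
elim: m k => // m IHm k /ltnSE le_m le_kn r relr x.
have [eq_kn | ne_kn] := eqVneq k n.
  subst k; suff -> : \det (\matrix_(i < n, j < n) r i j) = 0.
    by rewrite scale0r.
  apply: faithC => z; have [c ->] := gen z.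
  rewrite scaler_sumr big1 // => l _.
  rewrite scalerA mulrC -scalerA det_relations_annihilate ?scaler0 // => i.
  by under eq_bigr => j _ do rewrite mxE; apply: relr.
have lt_kn : (k < n)%N by rewrite ltn_neqAle ne_kn.
(* The given relations, with [c] as an extra last row. *)
pose mx (c : nat -> R) : 'M_k.+1 :=
  \matrix_(i, j) (if (i < k)%N then r i j else c j).
(* Cofactors along the last row do not depend on that row, so it is filled with 0. Weight 0 past
   column [k] lets sums run over all [n] generators. *)
pose w j :=
  if (j < k.+1)%N then cofactor (mx (fun=> 0)) ord_max (inord j) else 0.
have det_mxE (c : nat -> R) : \det (mx c) = \sum_(j < n) c j * w j.
  rewrite (expand_det_row _ ord_max).
  transitivity (\sum_(j < k.+1) c j * w j).
    apply: eq_bigr => j _; rewrite /w ltn_ord inord_val mxE ltnn.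
    congr (_ * (_ * \det _)); apply/matrixP => i l.
    by rewrite !mxE lift_max ltn_ord.
  rewrite (big_ord_widen n (fun j => c j * w j)) // big_mkcond.
  by apply: eq_bigr => j _; rewrite /w; case: (j < k.+1)%N; rewrite ?mulr0.
have [|f fE] := linear_on_generators (N := N) gen (y := fun j => w j *: x).
  move=> c relc.
  (* Extends [c] by 0; only indices below [n] are ever read. *)
  pose c' j := if insub j is Some l then c l else 0.
  have c'E (j : 'I_n) : c' j = c j by rewrite /c' valK.
  under eq_bigr => j _ do rewrite scalerA -c'E.
  rewrite -scaler_suml -det_mxE.
  pose r' i j := if (i < k)%N then r i j else c' j.
  apply: (IHm k.+1 _ lt_kn r') => [|i _].
    by rewrite subnS prednK ?subn_gt0.
  rewrite /r'; case: ltnP => [lt_ik | _]; first exact: relr.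
  by under eq_bigr => j _ do rewrite c'E.
(* The weight at index [k] is the bottom-right cofactor: its sign is (-1)^(2k) = 1, and deleting the
   last row and column leaves the given minor. *)
have := homCN f (e (Ordinal lt_kn)); rewrite fE /w ltnSn => <-.
congr (_ *: x); rewrite /cofactor.
have -> : inord k = ord_max :> 'I_k.+1 by apply/val_inj; rewrite /= inordK.
rewrite addnn -signr_odd odd_double mul1r; congr (\det _).
by apply/matrixP => i j; rewrite !mxE !lift_max ltn_ord.
Qed.

Lemma faithful_fg_Hom_zero (R : comPzRingType) (C N : lmodType R) :
  finitely_generated C -> faithful_module C -> Hom_zero C N -> zero_module N.
Proof.
move=> [n [e gen]] faithC homCN x.
have := leading_minors_annihilate gen faithC homCN (leq0n n).
by move=> /(_ (fun _ _ => 0) _ x); rewrite det_mx00 scale1r; apply.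
Qed.

Theorem proposition3p6 (R : comPzRingType) (C : lmodType R) :
  semidualizing C -> faithfully_semidualizing C.
Proof.
move=> sdC; split=> // N; have [[P fgP] [inj _] _] := sdC.
apply: faithful_fg_Hom_zero.
  (* The augmentation makes [C] a quotient of [P 0]. *)
  exact: finitely_generated_surj (res_aug_surjective P) (fgP 0%N).
by move=> r r0; apply: inj => x; rewrite r0 scale0r.
Qed.
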